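(* Let $p\ge 2$ be an even integer, $m\ge 3$ an odd integer, and let $G$ be a $(p,q)$-graph with $V(G)=\{u_i\mid 1\le i\le p\}$. Suppose the following three conditions hold. (a) For some $t\ge 2$, $G$ is a $t$-partite graph with partite sets $V_l$, $1\le l\le t$, such that $|V_l|=s_l$ with $s_{l+1}\ge s_l\ge 1$. (b) $G$ admits a bijective total labeling $g:V(G)\cup E(G)\to[1,p+q]$, with induced color of $u$ given by $g^+_{tn}(u)=\sum_{x\in N(u)}[g(ux)+g(x)]$, such that for each $1\le l\le t$: if $s_l=1$, then the only induced color in $V_l$ is $\alpha_l$; and if $s_l\ge 2$, then all the induced colors of the vertices of $V_l$ form (in some order) an arithmetic sequence with first term $\alpha_l$ and common difference $d_l$. (A) There exists a $p\times m$ matrix $A_{p\times m}$ whose set of entries is $[1,pm]$, all of whose column sums are equal to the constant $p(pm+1)/2$, and whose $p$ row sums (one for each row) can be partitioned into $t$ collections $S_l$, $1\le l\le t$, with $S_l$ of size $s_l$, such that: if $s_l=1$, then the only element of $S_l$ is $\beta_l$; and if $s_l\ge 2$, then all the elements of $S_l$ form (in some order) an arithmetic sequence with first term $\beta_l$ and common difference $-d_l$. Let $H$ be an $(m,\nu)$-graph with $V(H)=\{v_j\mid 1\le j\le m\}$ and $\chi(H)=\chi_{ltna}(H)=t'\ge 2$, and let $h$ be a local total neighborhood antimagic $t'$-coloring of $H$. Suppose that (i) $\alpha_l+\beta_l\ne\alpha_{l'}+\beta_{l'}$ for all $1\le l<l'\le t$; (ii) for all $1\le l\le t$ and $1\le j\le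 m$, $$\alpha_l+\beta_l+m(2p+2q+pm)+\sum_{k=1}^m h(v_k)\ne\sum_{i=1}^p g(u_i)+\frac{p(pm+1)}{2}+p(p+q)+h^+_{tn}(v_j)+2d_H(v_j)(p+q+pm);$$ (iii) for all $1\le j\ne j'\le m$, $h^+_{tn}(v_j)=h^+_{tn}(v_{j'})$ implies $d_H(v_j)=d_H(v_{j'})$; (iv) for all $1\le j\ne j'\le m$, $h^+_{tn}(v_j)\ne h^+_{tn}(v_{j'})$ implies $h^+_{tn}(v_j)-h^+_{tn}(v_{j'})\ne 2(p+q+pm)[d_H(v_{j'})-d_H(v_j)]$. Then $\chi_{ltna}(G\vee H)\le t+t'$. Equality holds if $\chi(G)=t$.
   Context: All graphs are finite and simple. A $(p,q)$-graph is a graph with $p$ vertices and $q$ edges. For integers $a<b$, $[a,b]=\{a,a+1,\dots,b\}$. $N(u)$ is the set of neighbors of $u$; $d_H(v)$ is the degree of $v$ in $H$; $\chi$ is the chromatic number. The join $G\vee H$ of (vertex-disjoint) graphs has $V(G\vee H)=V(G)\cup V(H)$ and $E(G\vee H)=E(G)\cup E(H)\cup\{uv\mid u\in V(G),v\in V(H)\}$. For a graph $G=(V,E)$ of order $p$ and size $q$, a bijective total labeling is a bijection $f:V\cup E\to\{1,\dots,p+q\}$; its induced vertex coloring is $f^+_{tn}(u)=\sum_{ux\in E}[f(ux)+f(x)]$, with $f^+_{tn}(u)=0$ if $u$ is isolated. Such an $f$ is a local total neighborhood antimagic labeling of $G$ if $f^+_{tn}(u)\ne f^+_{tn}(v)$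 for every edge $uv\in E$. The number of distinct induced colors is $c_{tn}(f)$, and $f$ is then also called a local total neighborhood antimagic $c_{tn}(f)$-coloring of $G$. The local total neighborhood antimagic chromatic number $\chi_{ltna}(G)$ is the minimum of $c_{tn}(f)$ over all local total neighborhood antimagic labelings $f$ of $G$. It is considered for graphs of order at least 2 without isolated vertices that admit such a labeling; thus an assertion $\chi_{ltna}(G)\le k$ or $\chi_{ltna}(G)=k$ includes the assertion that $G$ admits such a labeling. *)

(* Defs.v *)
From mathcomp Require Import all_boot all_order all_algebra.

Set Implicit Arguments.
Unset Strict Implicit.
Unset Printing Implicit Defensive.

Import GRing.Theory.

Record sgraph := SGraph {
  svertex :> finType;
  adj : rel svertex;
  adj_sym : symmetric adj;
  adj_irrefl : irreflexive adj }.

Definition neighbors (G : sgraph) (u : G) : {set G} := [set x | adj u x].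

Definition edges (G : sgraph) : {set {set G}} :=
  [set [set x; y] | x in [set: G], y in neighbors x].

Definition degree (G : sgraph) (u : G) : nat := #|neighbors u|.

Definition join_adj (G H : sgraph) (x y : G + H) : bool :=
  match x, y with
  | inl u, inl u' => adj u u'
  | inr v, inr v' => adj v v'
  | _, _ => true
  end.

Lemma join_adj_sym (G H : sgraph) : symmetric (@join_adj G H).
Proof. by move=> [u|v] [u'|v'] //=; apply: adj_sym. Qed.

Lemma join_adj_irrefl (G H : sgraph) : irreflexive (@join_adj G H).
Proof. by move=> [u|v] /=; apply: adj_irrefl. Qed.

Definition gjoin (G H : sgraph) : sgraph :=
  SGraph (@join_adj_sym G H) (@join_adj_irrefl G H).

Definition colorable (G : sgraph) (k : nat) : bool :=
  [exists c : {ffun G -> 'I_k},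
    [forall x, forall y, adj x y ==> (c x != c y)]].

Lemma colorable_card (G : sgraph) : exists k, colorable G k.
Proof.
exists #|G|; apply/existsP; exists [ffun x => enum_rank x].
apply/forallP=> x; apply/forallP=> y; apply/implyP=> xy.
rewrite !ffunE (inj_eq enum_rank_inj).
by apply: contraTneq xy => ->; rewrite adj_irrefl.
Qed.

Definition chi (G : sgraph) : nat := ex_minn (colorable_card G).

(* V(G) and E(G) together; a total labeling is a function on [G + {set G}],
   of which only the values on this set matter. *)
Definition elements (G : sgraph) : {set G + {set G}} :=
  [set z | if z is inr e then e \in edges G else true].

Definition total_labeling (G : sgraph) : Type := G + {set G} -> nat.

Definition bijective_labeling (G : sgraph) (f : total_labeling G) : Prop :=
  [/\ {in elements G, forall z, 1 <= f z <= #|G| + #|edges G|},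
      {in elements G &, injective f}
    & forall n, 1 <= n <= #|G| + #|edges G| ->
        exists2 z, z \in elements G & f z = n].

Definition vlabel (G : sgraph) (f : total_labeling G) (x : G) : nat :=
  f (inl x).

Definition elabel (G : sgraph) (f : total_labeling G) (x y : G) : nat :=
  f (inr [set x; y]).

(* The induced color f^+_{tn}(u). *)
Definition tn_color (G : sgraph) (f : total_labeling G) (u : G) : nat :=
  \sum_(x in neighbors u) (elabel f u x + vlabel f x).

Definition ltna_labeling (G : sgraph) (f : total_labeling G) : Prop :=
  bijective_labeling f /\
  forall u v : G, adj u v -> tn_color f u <> tn_color f v.

(* The number c_{tn}(f) of distinct induced colors. *)
Definition tn_ncolors (G : sgraph) (f : total_labeling G) : nat :=
  size (undup [seq tn_color f u | u : G]).

Definition ltna_coloring (G : sgraph) (k : nat) (f : total_labeling G) : Prop :=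
  ltna_labeling f /\ tn_ncolors f = k.

(* [chi_ltna_eq G k] says that chi_{ltna}(G) is defined and equal to k. It is
   defined only for the graphs of order at least 2 without isolated vertices
   that admit a local total neighborhood antimagic labeling. *)
Definition chi_ltna_eq (G : sgraph) (k : nat) : Prop :=
  [/\ 2 <= #|G|,
      forall u : G, exists v : G, adj u v,
      exists f : total_labeling G, ltna_coloring k f
    & forall f : total_labeling G, ltna_labeling f -> k <= tn_ncolors f].

Definition chi_ltna_le (G : sgraph) (k : nat) : Prop :=
  exists2 c, chi_ltna_eq G c & c <= k.

Definition partition_family (T : finType) (t : nat) (V : 'I_t -> {set T}) :
    Prop :=
  (forall x : T, exists l, x \in V l) /\
  (forall l l' : 'I_t, l != l' -> [disjoint V l & V l']).

Definition partite_sets (G : sgraph) (t : nat) (V : 'I_t -> {set G}) : Prop :=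
  partition_family V /\
  forall l, {in V l &, forall u v, ~~ adj u v}.

(* The values of c on A, listed with multiplicity, are in some order
   a, a + d, ..., a + (#|A| - 1) d; when #|A| = 1 this says that the only
   value is a, whatever d is. *)
Definition arith_values (T : finType) (c : T -> nat) (A : {set T}) (a d : int) :
    Prop :=
  perm_eq [seq (c x)%:Z%R | x in A] [seq (a + d *+ k)%R | k <- iota 0 #|A|].

Definition row_sum (p m : nat) (A : 'M[nat]_(p, m)) (i : 'I_p) : nat :=
  \sum_(j < m) A i j.

Definition col_sum (p m : nat) (A : 'M[nat]_(p, m)) (j : 'I_m) : nat :=
  \sum_(i < p) A i j.

(* Main.v *)
(** Label G by g, the edge joining u_i to v_j by p + q + A_ij for a suitable
    indexing of the u_i by rows of A, and H by h shifted by p + q + pm. On V_l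
    the colors of g increase with step d_l while the row sums over S_l decrease
    with step d_l, so pairing them by rank gives every vertex of V_l the same
    induced color in G \vee H; the column sums being constant, the induced color
    of v_j depends only on h^+_tn(v_j) by (iii). Hence at most t + t' colors are
    used, and (i), (ii), (iv) say that adjacent vertices get distinct ones.
    Conversely the induced colors always form a proper coloring of G \vee H, in
    which G and H share no color. *)

Require Import Defs.
From mathcomp Require Import all_boot all_order all_algebra.
From mathcomp Require Import zify.
From Stdlib Require Import Classical.

(** * Edges and bijectivity of total labelings *)

Lemma edgesP (G : sgraph) (e : {set G}) :
  reflect (exists x y : G, adj x y /\ e = [set x; y]) (e \in edges G).
Proof.
apply: (iffP imset2P) => [[x y _]|[x [y [xy ->]]]].
  by rewrite inE => xy ->; exists x, y.
by exists x y; rewrite ?inE.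
Qed.

Lemma edge_neq0 (G : sgraph) (e : {set G}) : e \in edges G -> e != set0.
Proof.
move=> /edgesP [x [y [_ ->]]]; apply/set0Pn; exists x.
by rewrite !inE eqxx.
Qed.

(** A pigeonhole count: at most [K] elements cover the [K] values, so the list of labels has no
    repetition and [K] equals the order plus the size. Only an upper bound on the number of edges is
    then needed to apply it. *)
Lemma surjective_bijective_labeling (G : sgraph) (f : total_labeling G) (K : nat) :
    #|G| + #|edges G| <= K ->
    (forall n, 1 <= n <= K -> exists2 z, z \in elements G & f z = n) ->
  bijective_labeling f.
Proof.
move=> leK f_surj.
have le_elements : #|elements G| <= #|G| + #|edges G|.
  have -> : elements G = (inl @: [set: G]) :|: (inr @: edges G).
    apply/setP=> -[x|e]; rewrite !inE.
      by rewrite imset_f.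
    rewrite (mem_imset _ _ inr_inj); case: imsetP => // -[x _] //.
  rewrite -[#|G|](cardsT G).
  by rewrite (leq_trans (leq_card_setU _ _)) // leq_add ?leq_imset_card.
set s := [seq f z | z <- enum (elements G)].
have sub : {subset iota 1 K <= s}.
  move=> n; rewrite mem_iota add1n ltnS => /f_surj [z zE <-].
  by rewrite map_f ?mem_enum.
have size_s : size s = #|elements G| by rewrite size_map -cardE.
have le_s : size s <= size (iota 1 K).
  by rewrite size_iota size_s (leq_trans le_elements).
have [size_eq mem_eq] := uniq_min_size (iota_uniq 1 K) sub le_s.
have defK : K = #|G| + #|edges G|.
  apply/eqP; rewrite eqn_leq leK andbT.
  by rewrite -(size_iota 1 K) size_eq size_s.
have uniq_s := leq_size_uniq (iota_uniq 1 K) sub le_s.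
rewrite /bijective_labeling -defK.
split=> //; last exact/dinjectiveP.
move=> z zE; have : f z \in s by rewrite map_f ?mem_enum.
by rewrite -mem_eq mem_iota add1n ltnS.
Qed.

(** * Counting distinct colors *)

Lemma size_undup_factor (T : eqType) (A B : eqType) (a : T -> A) (b : T -> B)
    (s : seq T) :
    (forall x y, a x = a y -> b x = b y) ->
  size (undup (map b s)) <= size (undup (map a s)).
Proof.
move=> ab; elim: s => //= x s IHs.
case: ifP => bx; case: ifP => ax //=; [exact: leq_trans IHs _|].
case/mapP: ax => y ys /ab bxy.
by rewrite bxy map_f in bx.
Qed.

(** The position of a color in the list of distinct colors serves as its number. *)
Lemma chi_le_ncolors (G : sgraph) (C : eqType) (c : G -> C) :
  (forall x y, adj x y -> c x <> c y) -> chi G <= size (undup (map c (enum G))).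
Proof.
move=> proper_c; rewrite /chi; case: ex_minnP => n _; apply.
have lt_c x : index (c x) (undup (map c (enum G))) < size (undup (map c (enum G))).
  by rewrite index_mem mem_undup map_f ?mem_enum.
apply/existsP; exists [ffun x => Ordinal (lt_c x)].
apply/forallP=> x; apply/forallP=> y; apply/implyP=> /proper_c xy.
rewrite !ffunE; apply/eqP=> -[] eqc; apply: xy; apply: (index_inj (c x)) eqc;
  by rewrite mem_undup map_f ?mem_enum.
Qed.

Lemma mem_map_enum_sum (C : eqType) (G H : finType) (c : G + H -> C) :
  [seq c z | z : G + H] =i [seq c (inl u) | u : G] ++ [seq c (inr v) | v : H].
Proof.
move=> n; rewrite mem_cat; apply/mapP/orP.
  move=> [[u|v] _ ->]; [left|right]; apply/mapP.
    by exists u; rewrite ?mem_enum.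
  by exists v; rewrite ?mem_enum.
by move=> [] /mapP [u _ ->]; [exists (inl u)|exists (inr u)]; rewrite ?mem_enum.
Qed.

(* An increasing progression met by a decreasing one of the same length:
   pairing terms of equal rank gives the constant sum [a + b]. *)
Lemma arith_values_matching (T T' : finType) (c : T -> nat) (c' : T' -> nat)
    (A : {set T}) (A' : {set T'}) (a b d : int) :
    #|A| = #|A'| -> 0 < #|A| ->
    arith_values c A a d -> arith_values c' A' b (- d)%R ->
  exists f : T -> T', [/\ {in A &, injective f},
    {in A, forall x, f x \in A'} &
    {in A, forall x, ((c x)%:Z + (c' (f x))%:Z)%R = (a + b)%R}].
Proof.
move=> eqA A_gt0 cA cA'.
(* The set can be listed so that the element of rank [n] has value [e + r *+ n]; [Is] holds the
   indices in [enum B] that sort the values this way. *)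
have arith_order (U : finType) (k : U -> nat) (B : {set U}) (e r : int) :
    0 < #|B| -> arith_values k B e r ->
  exists sB : seq U, [/\ perm_eq sB (enum B) &
    forall x0 n, n < #|B| -> (k (nth x0 sB n))%:Z%R = (e + r *+ n)%R].
  move=> B_gt0; rewrite /arith_values perm_sym => /(perm_iotaP 0%R) [Is pIs defs].
  have [x0 _] := card_gt0P B_gt0.
  exists [seq nth x0 (enum B) i | i <- Is]; split.
    apply/(perm_iotaP x0); exists Is => //.
    by rewrite size_map -cardE in pIs *.
  move=> x1 n ltn.
  have sIs : size Is = #|B| by rewrite (perm_size pIs) size_iota size_map -cardE.
  have lt_nth : nth 0 Is n < size (enum B).
    have : nth 0 Is n \in Is by rewrite mem_nth ?sIs.
    by rewrite (perm_mem pIs) mem_iota size_map.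
  rewrite (nth_map 0) ?sIs //.
  have := congr1 (fun s => nth 0%R s n) defs.
  rewrite (nth_map 0) ?size_iota // nth_iota // add0n => ->.
  by rewrite (nth_map 0) ?sIs // (nth_map x0).
have A'_gt0 : 0 < #|A'| by rewrite -eqA.
have [x0 _] := card_gt0P A_gt0; have [y0 _] := card_gt0P A'_gt0.
have [sA [pA cE]] := arith_order _ _ _ _ _ A_gt0 cA.
have [sA' [pA' cE']] := arith_order _ _ _ _ _ A'_gt0 cA'.
have szA : size sA = #|A| by rewrite (perm_size pA) cardE.
have szA' : size sA' = #|A| by rewrite (perm_size pA') -cardE.
have memA x : (x \in sA) = (x \in A) by rewrite (perm_mem pA) mem_enum.
have memA' x : (x \in sA') = (x \in A') by rewrite (perm_mem pA') mem_enum.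
have lt_index x : x \in A -> index x sA < #|A| by rewrite -szA index_mem memA.
(* Each element goes to the one of equal rank; the rank is below [#|A'|], so the default [y0] is
   never returned. *)
exists (fun x => nth y0 sA' (index x sA)); split.
- move=> x y xA yA /eqP.
  rewrite nth_uniq ?szA' ?lt_index ?(perm_uniq pA') ?enum_uniq // => /eqP.
  by apply: (index_inj x0); rewrite memA.
- by move=> x xA; rewrite -memA' mem_nth // szA' lt_index.
move=> x xA; have := cE x0 _ (lt_index x xA); rewrite nth_index ?memA // => ->.
rewrite cE' -?eqA ?lt_index // GRing.mulNrn GRing.addrACA GRing.subrr.
by rewrite GRing.addr0.
Qed.

Lemma partition_block (T : finType) (t : nat) (V : 'I_t -> {set T}) :
  partition_family V -> exists l : T -> 'I_t, forall x, x \in V (l x).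
Proof. by move=> [cover _]; apply: (fin_all_exists (P := fun x l => x \in V l)). Qed.

Lemma partition_family_inj (T : finType) (t : nat) (V : 'I_t -> {set T}) x l l' :
  partition_family V -> x \in V l -> x \in V l' -> l = l'.
Proof.
move=> [_ disj] xl xl'; apply/eqP; apply/negPn/negP=> /disj /disjoint_setI0 /setP /(_ x).
by rewrite !inE xl xl'.
Qed.

(** * The labeling of the join and its induced colors *)

Section Join.

Variables (G H : sgraph).
Notation J := (gjoin G H).

Lemma edge_join_ll (e : {set G}) : e \in edges G -> (inl @: e : {set J}) \in edges J.
Proof.
move=> /edgesP [x [y [xy ->]]]; apply/edgesP; exists (inl x), (inl y).
by rewrite imsetU !imset_set1.
Qed.

Lemma edge_join_rr (e : {set H}) : e \in edges H -> (inr @: e : {set J}) \in edges J.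
Proof.
move=> /edgesP [x [y [xy ->]]]; apply/edgesP; exists (inr x), (inr y).
by rewrite imsetU !imset_set1.
Qed.

Lemma edge_join_lr (u : G) (v : H) : ([set inl u; inr v] : {set J}) \in edges J.
Proof. by apply/edgesP; exists (inl u), (inr v). Qed.

(** The inequality suffices for [surjective_bijective_labeling], so the three families of edges need
    not be shown disjoint. *)
Lemma card_edges_join : #|edges J| <= #|edges G| + #|G| * #|H| + #|edges H|.
Proof.
pose cross : {set {set J}} :=
  (fun uv : G * H => [set inl uv.1; inr uv.2]) @: [set: G * H].
pose eG : {set {set J}} := (fun e : {set G} => inl @: e) @: edges G.
pose eH : {set {set J}} := (fun e : {set H} => inr @: e) @: edges H.
have sub : edges J \subset eG :|: cross :|: eH.
  apply/subsetP=> e /edgesP [[x|x] [[y|y] [/= xy ->]]]; rewrite !inE.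
  - apply/orP; left; apply/orP; left; apply/imsetP; exists [set x; y].
      by apply/edgesP; exists x, y.
    by rewrite imsetU !imset_set1.
  - apply/orP; left; apply/orP; right; apply/imsetP.
    by exists (x, y); rewrite ?inE.
  - apply/orP; left; apply/orP; right; apply/imsetP.
    by exists (y, x); rewrite ?inE //= setUC.
  - apply/orP; right; apply/imsetP; exists [set x; y].
      by apply/edgesP; exists x, y.
    by rewrite imsetU !imset_set1.
apply: leq_trans (subset_leq_card sub) _.
apply: leq_trans (leq_card_setU _ _) _.
rewrite leq_add ?leq_imset_card //.
apply: leq_trans (leq_card_setU _ _) _.
by rewrite leq_add ?leq_imset_card // -card_prod -cardsT leq_imset_card.
Qed.

(* An edge of J meeting both sides has a single vertex [u] in G and a single
   vertex [v] in H, so the double sum is just [B u v + N]. *)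
Definition join_labeling (g : total_labeling G) (h : total_labeling H)
    (B : G -> H -> nat) (N M : nat) : total_labeling J := fun z =>
  match z with
  | inl (inl u) => g (inl u)
  | inl (inr v) => h (inl v) + M
  | inr e =>
    let eG := [set u : G | inl u \in e] in
    let eH := [set v : H | inr v \in e] in
    if eH == set0 then g (inr eG)
    else if eG == set0 then h (inr eH) + M
    else \sum_(u in eG) \sum_(v in eH) (B u v + N)
  end.

Variables (g : total_labeling G) (h : total_labeling H) (B : G -> H -> nat).
Variables (N M : nat).
Notation f := (join_labeling g h B N M).

Lemma join_labeling_ll (e : {set G}) : f (inr (inl @: e)) = g (inr e).
Proof.
rewrite /join_labeling.
have -> : [set v : H | inr v \in (inl @: e : {set J})] = set0.
  by apply/setP=> v; rewrite !inE; apply/imsetP=> -[].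
rewrite eqxx; congr (g (inr _)); apply/setP=> u.
by rewrite inE mem_imset //; apply: inl_inj.
Qed.

(** The empty set is excluded because [join_labeling] tests [eH] first and would use [g] there. *)
Lemma join_labeling_rr (e : {set H}) : e != set0 ->
  f (inr (inr @: e)) = h (inr e) + M.
Proof.
move=> e_neq0; rewrite /join_labeling.
have -> : [set u : G | inl u \in (inr @: e : {set J})] = set0.
  by apply/setP=> v; rewrite !inE; apply/imsetP=> -[].
have -> : [set v : H | inr v \in (inr @: e : {set J})] = e.
  by apply/setP=> u; rewrite inE mem_imset //; apply: inr_inj.
by rewrite (negPf e_neq0) eqxx.
Qed.

Lemma join_labeling_lr (u : G) (v : H) :
  f (inr [set inl u; inr v]) = B u v + N.
Proof.
rewrite /join_labeling.
have -> : [set x : G | inl x \in ([set inl u; inr v] : {set J})] = [set u].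
  by apply/setP=> x; rewrite !inE orbF.
have -> : [set x : H | inr x \in ([set inl u; inr v] : {set J})] = [set v].
  by apply/setP=> x; rewrite !inE.
have nz (T : finType) (x : T) : ([set x] == set0) = false.
  by apply/negbTE/set0Pn; exists x; rewrite inE.
by rewrite !nz !big_set1.
Qed.

Lemma tn_color_join_l (u : G) :
  tn_color f (inl u) =
  tn_color g u + \sum_(v : H) (B u v + N + (vlabel h v + M)).
Proof.
rewrite /tn_color big_sumType /=; congr (_ + _).
  apply: eq_big => [x|x _]; first by rewrite !inE.
  rewrite /elabel /vlabel; congr (_ + _).
  by rewrite -join_labeling_ll imsetU !imset_set1.
apply: eq_big => [x|x _]; first by rewrite inE.
by rewrite /elabel /vlabel join_labeling_lr.
Qed.

(** Each neighbor of [v] in H brings [M] twice, once for its own label and once for the edge. *)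
Lemma tn_color_join_r (v : H) :
  tn_color f (inr v) =
  \sum_(u : G) (B u v + N + vlabel g u) + (tn_color h v + 2 * degree v * M).
Proof.
rewrite /tn_color big_sumType /=; congr (_ + _).
  apply: eq_big => [x|x _]; first by rewrite inE.
  by rewrite /elabel /vlabel setUC join_labeling_lr.
have -> : 2 * degree v * M = \sum_(x in neighbors v) (2 * M).
  by rewrite sum_nat_const /degree mulnCA mulnA.
rewrite -big_split /=.
apply: eq_big => [x|x _]; first by rewrite !inE.
rewrite /elabel /vlabel mul2n -addnn addnACA; congr (_ + _).
  rewrite -join_labeling_rr; first by rewrite imsetU !imset_set1.
  by apply/set0Pn; exists v; rewrite !inE eqxx.
Qed.

(** The labels up to [N] come from G, those from [N + 1] to [M] from the cross edges, and those
    above [M] from H. *)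
Lemma join_labeling_bijective :
    bijective_labeling g -> bijective_labeling h ->
    N = #|G| + #|edges G| -> M = N + #|G| * #|H| ->
    (forall n, 1 <= n <= #|G| * #|H| -> exists u v, B u v = n) ->
  bijective_labeling f.
Proof.
move=> [_ _ g_surj] [_ _ h_surj] defN defM B_surj.
apply: (@surjective_bijective_labeling _ _ (M + (#|H| + #|edges H|))).
  by rewrite card_sum; have := card_edges_join; lia.
move=> n /andP [n_ge1 n_le].
have [leN|ltN] := leqP n N.
  have [|[u|e] zE <-] := g_surj n; first lia.
    by exists (inl (inl u)); rewrite ?inE.
  rewrite inE in zE; exists (inr (inl @: e)); last exact: join_labeling_ll.
  by rewrite inE edge_join_ll.
have [leM|ltM] := leqP n M.
  have [|u [v Buv]] := B_surj (n - N); first lia.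
  exists (inr [set inl u; inr v]); first by rewrite inE edge_join_lr.
  by rewrite join_labeling_lr Buv; lia.
have [|[v|e] zE hz] := h_surj (n - M); first lia.
  by exists (inl (inr v)); rewrite ?inE //= hz; lia.
rewrite inE in zE; exists (inr (inr @: e)); first by rewrite inE edge_join_rr.
by rewrite join_labeling_rr ?edge_neq0 // hz; lia.
Qed.

End Join.

(** * Bounds on the number of colors and existence of the minimum *)

Lemma tn_ncolors_join_le (G H : sgraph) (f : total_labeling (gjoin G H)) :
  tn_ncolors f <= size (undup [seq tn_color f (inl u) | u : G])
                + size (undup [seq tn_color f (inr v) | v : H]).
Proof.
rewrite /tn_ncolors -size_cat uniq_leq_size ?undup_uniq // => n.
by rewrite mem_undup mem_map_enum_sum !mem_cat !mem_undup.
Qed.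

Lemma chi_le_tn_ncolors_join (G H : sgraph) (f : total_labeling (gjoin G H)) :
  ltna_labeling f -> chi G + chi H <= tn_ncolors f.
Proof.
move=> [_ f_proper].
have leG := @chi_le_ncolors G nat (fun u => tn_color f (inl u))
  (fun u v => f_proper (inl u) (inl v)).
have leH := @chi_le_ncolors H nat (fun u => tn_color f (inr u))
  (fun u v => f_proper (inr u) (inr v)).
apply: leq_trans (leq_add leG leH) _; rewrite -size_cat uniq_leq_size //.
  (* A color common to both sides would be shared by some [u] and [v], which are adjacent in the
     join. *)
  rewrite cat_uniq !undup_uniq andbT /=; apply/hasPn=> n.
  rewrite !mem_undup => /mapP [v _ ->]; apply/mapP=> -[u _] /esym.
  exact: f_proper.
by move=> n; rewrite mem_undup mem_map_enum_sum !mem_cat !mem_undup.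
Qed.

(** Descent on the number of colors; excluded middle decides whether a better labeling exists. This
    makes the chromatic number defined, as [chi_ltna_le] requires. *)
Lemma exists_min_ltna_labeling (G : sgraph) (f : total_labeling G) :
    ltna_labeling f ->
  exists f0 : total_labeling G, ltna_labeling f0 /\
    forall f1 : total_labeling G, ltna_labeling f1 ->
      tn_ncolors f0 <= tn_ncolors f1.
Proof.
have [n le_n] := ubnP (tn_ncolors f).
elim: n f le_n => // n IHn f le_n f_ltna.
have [[f1 [f1_ltna lt_f1]]|no_less] := classic (exists f1 : total_labeling G,
    ltna_labeling f1 /\ tn_ncolors f1 < tn_ncolors f).
  by apply: (IHn f1) => //; lia.
exists f; split=> // f1 f1_ltna; rewrite leqNgt; apply/negP=> lt_f1.
by apply: no_less; exists f1.
Qed.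

Lemma chi_ltna_le_labeling (G : sgraph) (f : total_labeling G) :
    2 <= #|G| -> (forall u : G, exists v : G, adj u v) -> ltna_labeling f ->
  chi_ltna_le G (tn_ncolors f).
Proof.
move=> G_ge2 no_isolated f_ltna.
have [f0 [f0_ltna f0_min]] := exists_min_ltna_labeling _ _ f_ltna.
by exists (tn_ncolors f0); [split=> //; exists f0|exact: f0_min].
Qed.

(** * The bound for the join and the case of equality *)

Theorem theorem2p4
  (p q m nu t t' : nat) (G H : sgraph)
  (hp : 2 <= p) (p_even : ~~ odd p) (hm : 3 <= m) (m_odd : odd m)
  (G_order : #|G| = p) (G_size : #|edges G| = q)
  (ht : 2 <= t) (V : 'I_t -> {set G}) (s : 'I_t -> nat)
  (V_partite : partite_sets V)
  (V_card : forall l, #|V l| = s l)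
  (s_ge1 : forall l, 1 <= s l)
  (s_mono : forall l l' : 'I_t, l' = l.+1 :> nat -> s l <= s l')
  (alpha beta d : 'I_t -> int)
  (g : total_labeling G) (g_bij : bijective_labeling g)
  (g_arith : forall l, arith_values (tn_color g) (V l) (alpha l) (d l))
  (A : 'M[nat]_(p, m))
  (A_entries : forall n : nat, 1 <= n <= p * m <-> exists i j, A i j = n)
  (A_cols : forall j, col_sum A j = (p * (p * m + 1)) %/ 2)
  (S : 'I_t -> {set 'I_p}) (S_part : partition_family S)
  (S_card : forall l, #|S l| = s l)
  (A_arith : forall l, arith_values (row_sum A) (S l) (beta l) (- d l)%R)
  (H_order : #|H| = m) (H_size : #|edges H| = nu)
  (ht' : 2 <= t') (H_chi : chi H = t') (H_ltna : chi_ltna_eq H t')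
  (h : total_labeling H) (h_col : ltna_coloring t' h)
  (cond_i : forall l l' : 'I_t, l < l' ->
     (alpha l + beta l)%R <> (alpha l' + beta l')%R)
  (cond_ii : forall (l : 'I_t) (v : H),
     (alpha l + beta l
      + (m * (2 * p + 2 * q + p * m) + (\sum_(w : H) vlabel h w))%N%:Z)%R
     <> ((\sum_(u : G) vlabel g u) + (p * (p * m + 1)) %/ 2 + p * (p + q)
         + tn_color h v + 2 * degree v * (p + q + p * m))%N%:Z%R)
  (cond_iii : forall v v' : H, v != v' ->
     tn_color h v = tn_color h v' -> degree v = degree v')
  (cond_iv : forall v v' : H, v != v' ->
     tn_color h v <> tn_color h v' ->
     ((tn_color h v)%:Z - (tn_color h v')%:Z)%R
     <> ((2 * (p + q + p * m))%N%:Z * ((degree v')%:Z - (degree v)%:Z))%R) :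
  chi_ltna_le (gjoin G H) (t + t') /\
  (chi G = t -> chi_ltna_eq (gjoin G H) (t + t')).
Proof.
have [G_adj V_indep] := V_partite.
have [l Vl] := partition_block _ _ _ G_adj.
(* [pi] assigns to each vertex of G its row of [A], gluing the matchings of each [V l0] with
   [S l0]. *)
have [pi pi_inj pi_sum] : exists2 pi : G -> 'I_p, injective pi &
    forall u, ((tn_color g u + row_sum A (pi u))%N%:Z = alpha (l u) + beta (l u))%R.
  have matching l0 : exists F : G -> 'I_p, [/\ {in V l0 &, injective F},
      {in V l0, forall u, F u \in S l0} &
      {in V l0, forall u, ((tn_color g u)%:Z + (row_sum A (F u))%:Z)%R
                          = (alpha l0 + beta l0)%R}].
    by apply: arith_values_matching (g_arith l0) (A_arith l0); rewrite V_card ?S_card.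
  have [F F_matching] := fin_all_exists matching.
  exists (fun u => F (l u) u) => [u u' eqF|u].
    have [F_inj FS _] := F_matching (l u).
    have [_ FS' _] := F_matching (l u').
    have SF := FS u (Vl u); have SF' := FS' u' (Vl u').
    rewrite eqF in SF.
    (* A common row lies in a single block of [S], so both vertices lie in the same block of [V],
       where the matching is injective. *)
    have ll' := partition_family_inj _ _ _ _ _ _ S_part SF SF'.
    by rewrite -ll' in eqF; apply: F_inj => //; rewrite ll'.
  have [_ _ F_sum] := F_matching (l u).
  by rewrite PoszD F_sum.
have pi_bij : bijective pi by apply: inj_card_bij; rewrite ?card_ord ?G_order.
(* Any bijection onto the columns will do, since all column sums agree. *)
pose rho (v : H) : 'I_m := cast_ord H_order (enum_rank v).
have rho_bij : bijective rho.
  by apply: inj_card_bij; [move=> v v' /cast_ord_inj /enum_rank_inj|rewrite card_ord H_order].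
pose B u v := A (pi u) (rho v).
have rowB u : \sum_(v : H) B u v = row_sum A (pi u).
  by rewrite /row_sum (reindex rho) //; apply: onW_bij.
have colB v : \sum_(u : G) B u v = (p * (p * m + 1)) %/ 2.
  by rewrite -(A_cols (rho v)) /col_sum (reindex pi) //; apply: onW_bij.
pose f := join_labeling G H g h B (p + q) (p + q + p * m).
have [[h_bij h_proper] h_ncolors] := h_col.
have f_bij : bijective_labeling f.
  apply: join_labeling_bijective => //; rewrite ?G_order ?G_size ?H_order //.
  move=> n /A_entries [i [j <-]].
  have [pi' _ pi'K] := pi_bij; have [rho' _ rho'K] := rho_bij.
  by exists (pi' i), (rho' j); rewrite /B pi'K rho'K.
(* The constant collects [m] copies of the two shifts [p + q] and [p + q + p * m]. *)
have color_l u : (tn_color f (inl u))%:Z%R = (alpha (l u) + beta (l u)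
    + (m * (2 * p + 2 * q + p * m) + (\sum_(w : H) vlabel h w))%N%:Z)%R.
  rewrite -pi_sum tn_color_join_l !big_split /= rowB !sum_nat_const H_order.
  by lia.
have color_r v : tn_color f (inr v) = (\sum_(u : G) vlabel g u)
    + (p * (p * m + 1)) %/ 2 + p * (p + q)
    + tn_color h v + 2 * degree v * (p + q + p * m).
  rewrite tn_color_join_r !big_split /= colB !sum_nat_const G_order.
  by lia.
have f_ltna : ltna_labeling f.
  split=> // -[u|v] [u'|v'] /=.
  - move=> uu' eq_color.
    have := congr1 Posz eq_color; rewrite !color_l => /GRing.addIr eq_ab.
    (* Adjacent vertices of G lie in different partite sets, so (i) applies in one order or the
       other. *)
    have neq_l : l u <> l u'.
      move=> eq_l; have := V_indep (l u) u u' (Vl u).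
      by rewrite {1}eq_l => /(_ (Vl u')); rewrite uu'.
    have [lt_l|lt_l|/val_inj //] := ltngtP (l u) (l u').
      exact: cond_i lt_l eq_ab.
    exact: cond_i lt_l (esym eq_ab).
  - move=> _ /(congr1 Posz); rewrite color_l color_r.
    exact: cond_ii.
  - move=> _ /esym /(congr1 Posz); rewrite color_l color_r.
    exact: cond_ii.
  move=> vv' eq_color; have neq_v : v != v'.
    by apply: contraTneq vv' => ->; rewrite adj_irrefl.
  (* Equal colors in the join would give exactly the equation that (iv) forbids, once the degree
     terms are moved to one side. *)
  apply: (cond_iv _ _ neq_v (h_proper _ _ vv')).
  by move: eq_color; rewrite !color_r; lia.
have f_ncolors : tn_ncolors f <= t + t'.
  apply: leq_trans (tn_ncolors_join_le _ _ f) _; rewrite leq_add //.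
    (* On G the color is a function of the block index, which takes at most [t] values. *)
    apply: (@leq_trans (size (undup [seq l u | u : G]))).
      apply: size_undup_factor => u u' eq_l.
      by apply: (congr1 absz (x := Posz _) (y := Posz _)); rewrite !color_l eq_l.
    rewrite -[X in _ <= X]card_ord cardE uniq_leq_size ?undup_uniq // => i _.
    by rewrite mem_enum.
  (* On H the color is a function of the color under [h], since (iii) makes the degree one too. *)
  rewrite -h_ncolors; apply: size_undup_factor => v v' eq_h.
  rewrite !color_r eq_h; have [-> //|neq_v] := eqVneq v v'.
  by rewrite (cond_iii v v').
have J_ge2 : 2 <= #|gjoin G H| by rewrite card_sum; lia.
have J_no_isolated (x : gjoin G H) : exists y, adj x y.
  have /card_gt0P [u0 _] : 0 < #|G| by lia.
  have /card_gt0P [v0 _] : 0 < #|H| by lia.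
  by case: x => [u|v]; [exists (inr v0)|exists (inl u0)].
split.
  have [c c_eq c_le] := chi_ltna_le_labeling _ _ J_ge2 J_no_isolated f_ltna.
  by exists c => //; apply: leq_trans f_ncolors.
(* Now [t + t'] equals [chi G + chi H], a lower bound for every labeling; hence [f] attains it and
   is optimal. *)
move=> chi_G; split=> //.
  exists f; split=> //; apply/eqP; rewrite eqn_leq f_ncolors /=.
  by rewrite -chi_G -H_chi chi_le_tn_ncolors_join.
by move=> f1 f1_ltna; rewrite -chi_G -H_chi chi_le_tn_ncolors_join.
Qed.
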